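(* Let $n\ge 2$ and consider the pair $(\beta_{1_a},\beta_{2_a})$ of transversal linear reflections on $(\mathbb{C}^n,0)$, of orders $k_1,k_2\ge2$ and with eigenvalues $\lambda_1,\lambda_2\ne1$, respectively, given by $$\beta_{1_a}(x)=(\lambda_1x_1,\ x_2+a_{12}x_1,\ x_3+a_{13}x_1,\dots,x_n+a_{1n}x_1),$$ $$\beta_{2_a}(x)=(x_1+a_{21}x_2,\ \lambda_2x_2,\ x_3+a_{23}x_2,\dots,x_n+a_{2n}x_2),$$ where $\lambda_i$ is a primitive $k_i$-th root of unity and $a_{ij}\in\mathbb{C}$. Let $\Lambda=\langle\beta_{1_a},\beta_{2_a}\rangle$ be the group they generate. If $\Lambda$ is Abelian, then $(\beta_{1_a},\beta_{2_a})$ is equivalent to $(\varphi_1,\varphi_2)$, where $\varphi_1(x)=(\lambda_1x_1,x_2,\dots,x_n)$ and $\varphi_2(x)=(x_1,\lambda_2x_2,x_3,\dots,x_n)$. If $\Lambda$ is non-Abelian, then the following hold. (i) If $a_{12}a_{21}\neq(\lambda_1-1)(\lambda_2-1)$, then $(\beta_{1_a},\beta_{2_a})$ is equivalent to $(\gamma_1,\gamma_2)$, where $$\gamma_1(x)=(\lambda_1x_1,\ x_1+x_2,\ x_3,\dots,x_n),\qquad \gamma_2(x)=(x_1,\lambda_2x_2,x_3,\dots,x_n)$$ whenever $a_{21}=0$, and $$\gamma_1(x)=(\lambda_1x_1,\ a_{12}a_{21}x_1+x_2,\ x_3,\dots,x_n),\qquad \gamma_2(x)=(x_1+x_2,\lambda_2x_2,x_3,\dots,x_n)$$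 whenever $a_{21}\ne0$. (ii) If $n\ge3$ and $a_{12}a_{21}=(\lambda_1-1)(\lambda_2-1)$, then $(\beta_{1_a},\beta_{2_a})$ is equivalent to $(\gamma_1,\gamma_2)$, where $$\gamma_1(x)=(\lambda_1x_1,\ (\lambda_1-1)(\lambda_2-1)x_1+x_2,\ x_3,\dots,x_n),\qquad \gamma_2(x)=(x_1+x_2,\lambda_2x_2,x_3,\dots,x_n)$$ whenever $(a_{23},\dots,a_{2n})=\frac{a_{21}}{\lambda_1-1}(a_{13},\dots,a_{1n})$, and $$\gamma_1(x)=(\lambda_1x_1,\ (\lambda_1-1)(\lambda_2-1)x_1+x_2,\ x_3,\dots,x_n),\qquad \gamma_2(x)=(x_1+x_2,\ \lambda_2x_2,\ x_2+x_3,\ x_4,\dots,x_n)$$ whenever $(a_{23},\dots,a_{2n})\ne\frac{a_{21}}{\lambda_1-1}(a_{13},\dots,a_{1n})$.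
   Context: Here $x=(x_1,\dots,x_n)\in(\mathbb{C}^n,0)$. A (complex) reflection is a germ of biholomorphism of $(\mathbb{C}^n,0)$ of finite order $\ge2$ whose fixed-point set is a submanifold of codimension $1$. Two reflections are transversal if their fixed-point sets are transversal at $0$ (so that their tangent spaces at $0$ intersect in codimension $2$). Two pairs of reflections $(\alpha_1,\alpha_2)$ and $(\beta_1,\beta_2)$ are equivalent if there is a germ of biholomorphism $h$ of $(\mathbb{C}^n,0)$ with $\beta_i=h\circ\alpha_i\circ h^{-1}$ for $i=1,2$. *)

(* Defs.v *)
From mathcomp Require Export all_boot all_order all_algebra complex.
From mathcomp Require Export all_classical all_reals all_analysis.
Export numFieldNormedType.Exports.

Set Implicit Arguments.
Unset Strict Implicit.
Unset Printing Implicit Defensive.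

Import GRing.Theory.
Local Open Scope ring_scope.
Local Open Scope complex_scope.
Local Open Scope classical_set_scope.

(* The complex numbers, packaged so that the normed-module structure of
   ['rV[Cplx R]_n] (sup norm) is inferred. *)
Definition Cplx (R : realType) : numClosedFieldType := R[i].

Section Germs.
Variables (R : realType) (n : nat).
Local Notation Cn := 'rV[Cplx R]_n.

(* Germs at 0 are represented by total functions; only the values near 0
   matter. *)
Definition germ_eq (f g : Cn -> Cn) : Prop :=
  \forall x \near nbhs (0 : Cn), f x = g x.

(* [differentiable] is taken over the scalar field [Cplx R], so the differentials
   are C-linear. *)
Definition holomorphic_germ (f : Cn -> Cn) : Prop :=
  f 0 = 0 /\ \forall x \near nbhs (0 : Cn), differentiable f x.

(* [h] is a germ of biholomorphism of (C^n, 0), with inverse germ [g]. *)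
Definition germ_inverse (h g : Cn -> Cn) : Prop :=
  [/\ holomorphic_germ h, holomorphic_germ g,
      germ_eq (g \o h) id & germ_eq (h \o g) id].

Definition equivalent_pairs (a b : (Cn -> Cn) * (Cn -> Cn)) : Prop :=
  exists h g : Cn -> Cn,
    [/\ germ_inverse h g,
        germ_eq b.1 (h \o a.1 \o g) & germ_eq b.2 (h \o a.2 \o g)].

(* Inverses are those of the group of germs of biholomorphisms. *)
Inductive generated_group (a b : Cn -> Cn) : (Cn -> Cn) -> Prop :=
| gen_id : generated_group a b id
| gen_left : generated_group a b a
| gen_right : generated_group a b b
| gen_comp f g :
    generated_group a b f -> generated_group a b g ->
    generated_group a b (f \o g)
| gen_inv f g :
    generated_group a b f -> germ_inverse f g -> generated_group a b g.

Definition abelian_germs (G : (Cn -> Cn) -> Prop) : Prop :=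
  forall f g, G f -> G g -> germ_eq (f \o g) (g \o f).

End Germs.

Section NormalForms.
Variables (R : realType) (n : nat) (n_ge2 : (2 <= n)%N).
Local Notation C := (Cplx R).
Local Notation Cn := 'rV[C]_n.

(* Coordinates are 0-based: x_1 and x_2 are the entries of index [ix1] and
   [ix2], and x_3 is the entry of index 2. *)
Definition ix1 : 'I_n := Ordinal (ltnW n_ge2).
Definition ix2 : 'I_n := Ordinal n_ge2.

(* The entry of index [ix1] of [a1] is not used, nor is that of index [ix2]
   of [a2].  When [l1] and [l2] are primitive roots of unity of orders
   k1, k2 >= 2, [beta1] and [beta2] are linear reflections of orders k1, k2;
   their fixed sets are the transversal hyperplanes x_1 = 0 and x_2 = 0. *)
Definition beta1 (l1 : C) (a1 : Cn) (x : Cn) : Cn :=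
  \row_j (if j == ix1 then l1 * x 0 ix1 else x 0 j + a1 0 j * x 0 ix1).

Definition beta2 (l2 : C) (a2 : Cn) (x : Cn) : Cn :=
  \row_j (if j == ix2 then l2 * x 0 ix2 else x 0 j + a2 0 j * x 0 ix2).

Definition phi1 (l1 : C) (x : Cn) : Cn :=
  \row_j (if j == ix1 then l1 * x 0 ix1 else x 0 j).

Definition phi2 (l2 : C) (x : Cn) : Cn :=
  \row_j (if j == ix2 then l2 * x 0 ix2 else x 0 j).

(* (l1 x_1, c x_1 + x_2, x_3, ..., x_n) *)
Definition gamma1 (l1 c : C) (x : Cn) : Cn :=
  \row_j (if j == ix1 then l1 * x 0 ix1
          else if j == ix2 then c * x 0 ix1 + x 0 ix2
          else x 0 j).

(* (x_1 + x_2, l2 x_2, x_3, ..., x_n) *)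
Definition gamma2 (l2 : C) (x : Cn) : Cn :=
  \row_j (if j == ix1 then x 0 ix1 + x 0 ix2
          else if j == ix2 then l2 * x 0 ix2
          else x 0 j).

(* (x_1 + x_2, l2 x_2, x_2 + x_3, x_4, ..., x_n) *)
Definition gamma2_third (l2 : C) (x : Cn) : Cn :=
  \row_j (if j == ix1 then x 0 ix1 + x 0 ix2
          else if j == ix2 then l2 * x 0 ix2
          else if j == 2 :> nat then x 0 ix2 + x 0 j
          else x 0 j).

End NormalForms.

(* Main.v *)
(* Each map is a linear reflection [x |-> x + x_i u], with [u] outside the
   hyperplane [x_i = 0].  A linear isomorphism fixing the form [x_1] and scaling
   [x_2] by [q] conjugates the pair given by [(u, v)] to the pair given by
   [(u', v')] as soon as it sends [u] to [u'] and [v] to [q v'], so every case is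
   a linear equivalence obtained by choosing [q] and moving two vectors.
   If [a12 a21 <> (l1 - 1)(l2 - 1)], the projections of [u] and [v] to the
   first two coordinates are independent and adding multiples of [x_1] and [x_2]
   to the coordinates kills the tails.  Otherwise [v - t u] is a tail
   vector with [t = a21 / (l1 - 1)]: it vanishes exactly when the tails are
   proportional, and if not a transvection-like map carries it to a multiple of
   [e_3].  The group is Abelian iff [a12 = a21 = 0]; the germs of the generators
   determine these entries by homogeneity. *)

Require Import Defs.
From mathcomp Require Import ring.
Import GRing.Theory.
Local Open Scope ring_scope.
Local Open Scope classical_set_scope.

(** * Germs at 0: commutation in a generated group, and homogeneous germs *)

Section GermCommutation.
Set Implicit Arguments.
Unset Strict Implicit.
Variables (R : realType) (n : nat).
Local Notation Cn := 'rV[Cplx R]_n.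

(** Continuity at 0 together with [f 0 = 0]: what allows a property holding near 0 to be pulled back
    along [f]. *)
Definition continuous_germ (f : Cn -> Cn) : Prop :=
  f @ nbhs (0 : Cn) --> nbhs (0 : Cn).

Definition germs_commute (f g : Cn -> Cn) : Prop :=
  germ_eq (f \o g) (g \o f).

Lemma germ_eq_all (f g : Cn -> Cn) : (forall x, f x = g x) -> germ_eq f g.
Proof. by move=> fg; apply: nearW. Qed.

Lemma near_germ (k : Cn -> Cn) (P : Cn -> Prop) : continuous_germ k ->
  (\forall y \near nbhs (0 : Cn), P y) ->
  \forall x \near nbhs (0 : Cn), P (k x).
Proof. by move=> kc Py; exact: kc. Qed.

Lemma continuous_germ_comp (f g : Cn -> Cn) :
  continuous_germ f -> continuous_germ g -> continuous_germ (f \o g).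
Proof. by move=> fc gc P /fc; exact: gc. Qed.

Lemma holomorphic_continuous_germ (f : Cn -> Cn) :
  holomorphic_germ f -> continuous_germ f.
Proof.
move=> [f0 /nbhs_singleton fd].
have : f @ nbhs (0 : Cn) --> f 0 := differentiable_continuous fd.
by rewrite f0.
Qed.

Lemma germs_commute_sym (f g : Cn -> Cn) :
  germs_commute f g -> germs_commute g f.
Proof. by apply: filterS => x ->. Qed.

(** Near 0, [g c = g c f g = g f c g = c g]. Commutation is used at the point [g x] and [g f = id]
    at [c (g x)], whence the need for continuity. *)
Lemma germs_commute_inverse (c f g : Cn -> Cn) : continuous_germ c ->
  germ_inverse f g -> germs_commute f c -> germs_commute g c.
Proof.
move=> cc [_ /holomorphic_continuous_germ gc gf fg] fc.
have cgc := continuous_germ_comp cc gc.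
have fcg := near_germ gc fc.
have gfcg := near_germ cgc gf.
near=> x.
have e1 : f (c (g x)) = c (f (g x)) by near: x; exact: fcg.
have e2 : f (g x) = x by near: x; exact: fg.
have e3 : g (f (c (g x))) = c (g x) by near: x; exact: gfcg.
by rewrite /= -e3 e1 e2.
Unshelve. all: by end_near. Qed.

Lemma germs_commute_comp (c f g : Cn -> Cn) : continuous_germ g ->
  germs_commute f c -> germs_commute g c -> germs_commute (f \o g) c.
Proof.
move=> gcont fc gc.
have fcg := near_germ gcont fc.
near=> x.
have e1 : g (c x) = c (g x) by near: x; exact: gc.
have e2 : f (c (g x)) = c (f (g x)) by near: x; exact: fcg.
by rewrite /= e1 e2.
Unshelve. all: by end_near. Qed.

Lemma continuous_germ_generated (a b f : Cn -> Cn) :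
  continuous_germ a -> continuous_germ b ->
  generated_group a b f -> continuous_germ f.
Proof.
move=> ca cb; elim=> // [f1 g1 _ + _|f1 g1 _ _ []].
- exact: continuous_germ_comp.
- by move=> _ /holomorphic_continuous_germ.
Qed.

Lemma germs_commute_generated (a b c f : Cn -> Cn) :
  continuous_germ a -> continuous_germ b -> continuous_germ c ->
  germs_commute a c -> germs_commute b c ->
  generated_group a b f -> germs_commute f c.
Proof.
move=> ca cb cc ac bc; elim=> // [|f1 g1 _ f1c Gg g1c|f1 g1 _ f1c f1g1].
- exact: germ_eq_all.
- by apply: germs_commute_comp => //; exact: continuous_germ_generated Gg.
- exact: germs_commute_inverse f1c.
Qed.

(** The germs commuting with a fixed one are closed under composition and inversion. This is used
    twice: [g] commutes with both generators, so both generators, and hence [f], commute with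
    [g]. *)
Lemma abelian_generated (a b : Cn -> Cn) :
  continuous_germ a -> continuous_germ b -> germs_commute a b ->
  abelian_germs (generated_group a b).
Proof.
move=> ca cb ab f g Gf Gg.
have self c : germs_commute c c by exact: germ_eq_all.
have cg := continuous_germ_generated ca cb Gg.
have ga : germs_commute g a.
  by apply: germs_commute_generated Gg => //; exact: germs_commute_sym.
have gb : germs_commute g b by exact: germs_commute_generated Gg.
by apply: germs_commute_generated Gf => //; exact: germs_commute_sym.
Qed.

Lemma mulmx_differentiable (H : 'M[Cplx R]_n) (x : Cn) :
  differentiable (fun y : Cn => y *m H) x.
Proof.
have -> : (fun y : Cn => y *m H) =
          \sum_(i < n) (fun y : Cn => y 0 i *: row i H).
  by apply: funext => y; rewrite mulmx_sum_row fct_sumE.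
by apply: differentiable_sum => i; exact/differentiableZl/differentiable_coord.
Qed.

Lemma mulmx_holomorphic (H : 'M[Cplx R]_n) :
  holomorphic_germ (fun x : Cn => x *m H).
Proof.
by split; [rewrite mul0mx | apply: nearW => x; exact: mulmx_differentiable].
Qed.

(** A small nonzero factor [t] brings any [x] into the neighbourhood of agreement; homogeneity then
    cancels it. *)
Lemma homogeneous_germ_eq (f g : Cn -> Cn) :
  (forall t x, f (t *: x) = t *: f x) -> (forall t x, g (t *: x) = t *: g x) ->
  germ_eq f g -> forall x, f x = g x.
Proof.
move=> fZ gZ fg x.
have : \forall t \near (0 : Cplx R)^', t *: f x = t *: g x.
  have tx : (t *: x @[t --> (0 : Cplx R)]) --> (0 : Cn).
    have : t *: x @[t --> (0 : Cplx R)] --> (0 : Cplx R) *: x.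
      exact: scalel_continuous.
    by rewrite scale0r.
  have /nbhs_dnbhs := tx _ fg.
  by apply: filterS => t /=; rewrite fZ gZ.
move=> near_eq.
have : \forall t \near (0 : Cplx R)^', t != 0 by exact: nbhs_dnbhs_neq.
move=> /(filterI near_eq) /filter_ex[t [e t0]].
by rewrite -[LHS](scalerK t0) e scalerK.
Qed.

End GermCommutation.

(** * Linear reflections: commutation and linear conjugacy *)

Section LinearReflections.
Set Implicit Arguments.
Unset Strict Implicit.
Variables (R : realType) (n : nat).
Local Notation C := (Cplx R).
Local Notation Cn := 'rV[C]_n.

(** Fixes the hyperplane x_i = 0 pointwise and multiplies [u] by [1 + u 0 i]. *)
Definition refl (i : 'I_n) (u x : Cn) : Cn := x + x 0 i *: u.

Lemma reflZ i u t x : refl i u (t *: x) = t *: refl i u x.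
Proof. by rewrite /refl scalerDr mxE scalerA. Qed.

Lemma refl_continuous_germ i u : continuous_germ (refl i u).
Proof.
apply: holomorphic_continuous_germ; split.
  by rewrite /refl mxE scale0r addr0.
apply: nearW => x; apply: differentiableD => //.
exact/differentiableZl/differentiable_coord.
Qed.

(** At the basis vector e_i, the k-th coordinates of the two composites are [u 0 k] and
    [u 0 k + u 0 k * v 0 k]. *)
Lemma germs_commute_refl_coord (i k : 'I_n) (u v : Cn) :
  i != k -> v 0 k != 0 -> germs_commute (refl i u) (refl k v) -> u 0 k = 0.
Proof.
move=> ik vk comm.
have commE := homogeneous_germ_eq
  (fun t x => etrans (congr1 _ (reflZ k v t x)) (reflZ i u t _))
  (fun t x => etrans (congr1 _ (reflZ i u t x)) (reflZ k v t _)) comm.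
have /rowP/(_ k) := commE (delta_mx 0 i).
rewrite /= /refl !mxE !eqxx [k == i]eq_sym (negPf ik) /= => e.
have : u 0 k * v 0 k = 0.
  apply: (@addrI _ (u 0 k)); rewrite addr0.
  by transitivity (0 + 0 * v 0 k + (1 + 0 * v 0 i) * u 0 k); [rewrite e; ring|ring].
by move/eqP; rewrite mulf_eq0 (negPf vk) orbF => /eqP.
Qed.

Lemma germs_commute_refl (i k : 'I_n) (u v : Cn) :
  u 0 k = 0 -> v 0 i = 0 -> germs_commute (refl i u) (refl k v).
Proof.
move=> uk vi; apply: germ_eq_all => x; apply/rowP => j.
by rewrite /= /refl !mxE uk vi; ring.
Qed.

(** Conjugation by [H] turns [u] into [u *m H] and divides the form x_i by [p]; the two factors [p]
    cancel. The same holds for [v], x_k and [q]. *)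
Lemma equivalent_of_unitmx (i k : 'I_n) (u v u' v' : Cn) (H : 'M[C]_n) (p q : C) :
  H \in unitmx ->
  (forall x : Cn, (x *m H) 0 i = p * x 0 i) ->
  (forall x : Cn, (x *m H) 0 k = q * x 0 k) ->
  u *m H = p *: u' -> v *m H = q *: v' ->
  equivalent_pairs (refl i u, refl k v) (refl i u', refl k v').
Proof.
move=> Hu Hi Hk uH vH.
have conj j w w' r : (forall x : Cn, (x *m H) 0 j = r * x 0 j) ->
    w *m H = r *: w' ->
    forall x, refl j w' x = refl j w (x *m invmx H) *m H.
  move=> Hj wH x; rewrite /refl mulmxDl mulmxKV // -scalemxAl wH scalerA.
  by rewrite mulrC -Hj mulmxKV.
exists (fun x => x *m H), (fun x => x *m invmx H); split.
- split; [exact: mulmx_holomorphic|exact: mulmx_holomorphic| |].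
  + by apply: germ_eq_all => x; rewrite /= mulmxK.
  + by apply: germ_eq_all => x; rewrite /= mulmxKV.
- exact/germ_eq_all/conj.
- exact/germ_eq_all/conj.
Qed.

Lemma mulmx_rank1 (x : Cn) (F : 'cV[C]_n) (c : Cn) :
  x *m (F *m c) = (x *m F) 0 0 *: c.
Proof. by rewrite mulmxA {1}[x *m F]mx11_scalar mul_scalar_mx. Qed.

Lemma mulmx_delta_col (x : Cn) (i : 'I_n) :
  (x *m (delta_mx i 0 : 'cV[C]_n)) 0 0 = x 0 i.
Proof. by rewrite -colE mxE. Qed.

(* The conjugation is [x |-> x + x_i c + x_k d + F(x) z]. *)
Lemma equivalent_refl (i k : 'I_n) (u v u' v' c d z : Cn) (F : 'cV[C]_n) (q : C) :
  q != 0 -> 1 + (z *m F) 0 0 != 0 ->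
  c 0 i = 0 -> c 0 k = 0 -> d 0 i = 0 -> 1 + d 0 k = q ->
  z 0 i = 0 -> z 0 k = 0 ->
  u + u 0 i *: c + u 0 k *: d + (u *m F) 0 0 *: z = u' ->
  v + v 0 i *: c + v 0 k *: d + (v *m F) 0 0 *: z = q *: v' ->
  equivalent_pairs (refl i u, refl k v) (refl i u', refl k v').
Proof.
move=> q0 fz ci ck di dk zi zk hu hv.
pose H : 'M[C]_n := 1%:M + delta_mx i 0 *m c + delta_mx k 0 *m d + F *m z.
have HE (x : Cn) :
    x *m H = x + x 0 i *: c + x 0 k *: d + (x *m F) 0 0 *: z.
  by rewrite /H !mulmxDr mulmx1 !mulmx_rank1 !mulmx_delta_col.
have Hi (x : Cn) : (x *m H) 0 i = x 0 i.
  by rewrite HE !mxE ci di zi; ring.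
have Hk (x : Cn) : (x *m H) 0 k = q * x 0 k.
  by rewrite HE !mxE ck zk -dk; ring.
apply: (@equivalent_of_unitmx _ _ _ _ _ _ H 1 q) => //.
(* Invertibility: a kernel vector has x_i = x_k = 0, so x + F(x) z = 0; applying F gives F(x) (1 +
   F(z)) = 0, hence F(x) = 0 and x = 0. *)
- rewrite -row_free_unit -kermx_eq0; apply/rowV0P => x /sub_kermxP xH.
  have xi : x 0 i = 0 by rewrite -Hi xH mxE.
  have xk : x 0 k = 0.
    have /eqP := Hk x; rewrite xH mxE eq_sym mulf_eq0 (negPf q0) /=.
    by move/eqP.
  have e : x + (x *m F) 0 0 *: z = 0.
    by rewrite -xH HE xi xk !scale0r !addr0.
  have := congr1 (fun y : Cn => (y *m F) 0 0) e.
  rewrite mulmxDl -scalemxAl mul0mx !mxE.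
  set f := (X in X + X * _) => ef.
  have /eqP : f * (1 + (z *m F) 0 0) = 0 by rewrite mulrDr mulr1 [in LHS]mxE.
  rewrite mulf_eq0 (negPf fz) orbF => /eqP f0.
  by rewrite -e [(x *m F) 0 0]mxE -/f f0 scale0r addr0.
- by move=> x; rewrite Hi mul1r.
- by rewrite HE hu scale1r.
- by rewrite HE hv.
Qed.

(* Cramer's rule for [a x + b y = r' - r] and [c x + d y = s' - s]; kept over an
   abstract field because [field] is very slow on [Cplx R]. *)
Fact cramerl (K : fieldType) (a b c d r s r' s' : K) :
  let D := a * d - b * c in D != 0 ->
  r + a * (D^-1 * (d * (r' - r) - b * (s' - s)))
    + b * (D^-1 * (a * (s' - s) - c * (r' - r))) = r'.
Proof. by move=> D D0; rewrite /D in D0 *; field. Qed.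

Fact cramerr (K : fieldType) (a b c d r s r' s' : K) :
  let D := a * d - b * c in D != 0 ->
  s + c * (D^-1 * (d * (r' - r) - b * (s' - s)))
    + d * (D^-1 * (a * (s' - s) - c * (r' - r))) = s'.
Proof. by move=> D D0; rewrite /D in D0 *; field. Qed.

Lemma combE (x c d : Cn) a b j :
  (x + a *: c + b *: d) 0 j = x 0 j + a * c 0 j + b * d 0 j.
Proof. by rewrite !mxE. Qed.

(** The unknowns [c], [d] solve u_i c + u_k d = u' - u and v_i c + v_k d = q v' - v by Cramer's rule
    in each coordinate. The conditions on entries i and k force c_i = c_k = d_i = 0 and d_k = q -
    1. *)
Lemma equivalent_refl_independent (i k : 'I_n) (u v u' v' : Cn) (q : C) :
  q != 0 -> u 0 i * v 0 k - u 0 k * v 0 i != 0 ->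
  u' 0 i = u 0 i -> u' 0 k = q * u 0 k ->
  q * v' 0 i = v 0 i -> v' 0 k = v 0 k ->
  equivalent_pairs (refl i u, refl k v) (refl i u', refl k v').
Proof.
move=> q0 D0 ui uk vi vk; set D := _ - _ in D0.
have [c cE] : exists c : Cn, forall j, c 0 j =
    D^-1 * (v 0 k * (u' 0 j - u 0 j) - u 0 k * (q * v' 0 j - v 0 j)).
  by eexists (\row_j _) => j; rewrite mxE.
have [d dE] : exists d : Cn, forall j, d 0 j =
    D^-1 * (u 0 i * (q * v' 0 j - v 0 j) - v 0 i * (u' 0 j - u 0 j)).
  by eexists (\row_j _) => j; rewrite mxE.
have hu : u + u 0 i *: c + u 0 k *: d = u'.
  by apply/rowP => j; rewrite combE cE dE; 
  exact: (@cramerl C _ _ _ _ (u 0 j) (v 0 j) (u' 0 j) (q * v' 0 j) D0).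
have hv : v + v 0 i *: c + v 0 k *: d = q *: v'.
  apply/rowP => j; rewrite combE cE dE [RHS]mxE; 
  exact: (@cramerr C _ _ _ _ (u 0 j) (v 0 j) (u' 0 j) (q * v' 0 j) D0).
apply: (@equivalent_refl i k u v u' v' c d 0 0 q) => //.
- by rewrite mulmx0 mxE addr0 oner_eq0.
- by rewrite cE ui vi !subrr; ring.
- by rewrite cE uk vk; ring.
- by rewrite dE ui vi !subrr; ring.
- rewrite dE uk vk.
  have -> : u 0 i * (q * v 0 k - v 0 k) - v 0 i * (q * u 0 k - u 0 k) =
            D * (q - 1) by rewrite /D; ring.
  by rewrite mulKf // addrC subrK.
- by rewrite mxE.
- by rewrite mxE.
- by rewrite scaler0 addr0.
- by rewrite scaler0 addr0.
Qed.

(* The hypotheses on [F] make [x |-> x + F(x) (q w' - w)] an isomorphism that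
   sends [w] to [q w']; [w = w' = 0] is allowed. *)
Lemma equivalent_refl_dependent (i k : 'I_n) (u w u' w' : Cn) (F : 'cV[C]_n)
    (q t : C) :
  i != k -> q != 0 -> u 0 i != 0 ->
  w 0 i = 0 -> w 0 k = 0 -> w' 0 i = 0 -> w' 0 k = 0 ->
  u' 0 i = u 0 i -> u' 0 k = q * u 0 k ->
  (w *m F) 0 0 *: (q *: w' - w) = q *: w' - w ->
  1 + ((q *: w' - w) *m F) 0 0 != 0 ->
  equivalent_pairs (refl i u, refl k (t *: u + w))
                   (refl i u', refl k ((t / q) *: u' + w')).
Proof.
move=> ik q0 u0 wi wk wi' wk' ui uk Fz z0; set z := _ - w in Fz z0.
(* [d] makes the conjugation scale x_k by [q]; [c] is then solved from the requirement that [u] go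
   to [u']. *)
pose d : Cn := (q - 1) *: delta_mx 0 k.
pose c : Cn := (u 0 i)^-1 *: (u' - u - u 0 k *: d - (u *m F) 0 0 *: z).
have hu : u + u 0 i *: c + u 0 k *: d + (u *m F) 0 0 *: z = u'.
  by rewrite /c scalerA divff // scale1r; apply/rowP => j; rewrite !mxE; ring.
have zi : z 0 i = 0 by rewrite !mxE wi wi'; ring.
have zk : z 0 k = 0 by rewrite !mxE wk wk'; ring.
have di : d 0 i = 0 by rewrite !mxE (negPf ik) andbF mulr0.
have dk : d 0 k = q - 1 by rewrite !mxE !eqxx mulr1.
have cE j : c 0 j =
    (u 0 i)^-1 * (u' 0 j - u 0 j - u 0 k * d 0 j - (u *m F) 0 0 * z 0 j).
  by rewrite !mxE.
apply: (@equivalent_refl i k _ _ _ _ c d z F q) => //.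
- by rewrite cE ui di zi subrr !mulr0 !subr0 mulr0.
- by rewrite cE uk dk zk; ring.
- by rewrite dk addrC subrK.
rewrite mulmxDl -scalemxAl.
(* By linearity [t *: u + w] goes to t u' + (w + z), and w + z = q w'. *)
transitivity (t *: (u + u 0 i *: c + u 0 k *: d + (u *m F) 0 0 *: z)
              + (w + (w *m F) 0 0 *: z)).
  set f := u *m F; set g := w *m F.
  by apply/rowP => j; rewrite !mxE wi wk; ring.
rewrite hu Fz scalerDr scalerA mulrC divfK //.
by rewrite /z [w + _]addrC subrK.
Qed.

(** Provides the form for the dependent case with w' = e_m: there 1 + F(q e_m - w) = q F(e_m), which
    must not vanish. If w_m = 0, the form x_m can be added without changing F(w). *)
Lemma exists_form_neq0 (w : Cn) (m : 'I_n) : w != 0 ->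
  exists2 F : 'cV[C]_n, (w *m F) 0 0 = 1 & F m 0 != 0.
Proof.
move=> /rV0Pn[j wj].
have [wm|wm] := eqVneq (w 0 m) 0.
  exists ((w 0 j)^-1 *: delta_mx j 0 + delta_mx m 0).
    rewrite mulmxDr -scalemxAr mxE mulmx_delta_col wm addr0.
    by rewrite mxE mulmx_delta_col mulVf.
  have mj : m != j by apply: contraNneq wj => <-; rewrite wm.
  by rewrite !mxE !eqxx (negPf mj) mulr0 add0r oner_eq0.
exists ((w 0 m)^-1 *: delta_mx m 0).
  by rewrite -scalemxAr mxE mulmx_delta_col mulVf.
by rewrite !mxE !eqxx mulr1 invr_eq0.
Qed.

End LinearReflections.

(** * The maps of the theorem written as reflections *)

Section NormalFormReflections.
Set Implicit Arguments.
Unset Strict Implicit.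
Variables (R : realType) (n : nat) (n_ge2 : (2 <= n)%N).
Local Notation C := (Cplx R).
Local Notation Cn := 'rV[C]_n.
Local Notation i1 := (ix1 n_ge2).
Local Notation i2 := (ix2 n_ge2).

Definition vec12 (a b : C) : Cn := a *: delta_mx 0 i1 + b *: delta_mx 0 i2.

Lemma vec12E (a b : C) j :
  vec12 a b 0 j = if j == i1 then a else if j == i2 then b else 0.
Proof.
rewrite !mxE /=; case: (eqVneq j i1) => [->|j1] /=.
  by rewrite mulr1 mulr0 addr0.
by case: eqVneq => _; rewrite mulr0 add0r ?mulr1 ?mulr0.
Qed.

Lemma ix21 : (i2 == i1) = false. Proof. by []. Qed.

Lemma beta1E (l : C) (a : Cn) :
  beta1 n_ge2 l a = refl i1 (\row_j if j == i1 then l - 1 else a 0 j).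
Proof.
apply: funext => x; apply/rowP => j; rewrite !mxE.
by case: eqVneq => [->|_]; ring.
Qed.

Lemma beta2E (l : C) (a : Cn) :
  beta2 n_ge2 l a = refl i2 (\row_j if j == i2 then l - 1 else a 0 j).
Proof.
apply: funext => x; apply/rowP => j; rewrite !mxE.
by case: eqVneq => [->|_]; ring.
Qed.

Lemma phi1E (l : C) : phi1 n_ge2 l = refl i1 (vec12 (l - 1) 0).
Proof.
apply: funext => x; apply/rowP => j; rewrite [LHS]mxE 2!mxE vec12E.
by case: eqVneq => [->|_]; [ring|case: eqVneq => _; ring].
Qed.

Lemma phi2E (l : C) : phi2 n_ge2 l = refl i2 (vec12 0 (l - 1)).
Proof.
apply: funext => x; apply/rowP => j; rewrite [LHS]mxE 2!mxE vec12E.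
have [->|j2] := eqVneq j i2; first by rewrite ix21; ring.
by case: eqVneq => _; ring.
Qed.

Lemma gamma1E (l c : C) : gamma1 n_ge2 l c = refl i1 (vec12 (l - 1) c).
Proof.
apply: funext => x; apply/rowP => j; rewrite [LHS]mxE 2!mxE vec12E.
case: eqVneq => [->|_]; first by ring.
by case: eqVneq => [->|_]; ring.
Qed.

Lemma gamma2E (l : C) : gamma2 n_ge2 l = refl i2 (vec12 1 (l - 1)).
Proof.
apply: funext => x; apply/rowP => j; rewrite [LHS]mxE 2!mxE vec12E.
case: eqVneq => [->|_]; first by ring.
by case: eqVneq => [->|_]; ring.
Qed.

Lemma gamma2_thirdE (l : C) (m : 'I_n) : m = 2%N :> nat ->
  gamma2_third n_ge2 l = refl i2 (vec12 1 (l - 1) + delta_mx 0 m).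
Proof.
move=> m2; apply: funext => x; apply/rowP => j.
rewrite [LHS]mxE 2!mxE [in RHS]mxE vec12E [delta_mx _ _ _ _]mxE eqxx /=.
have -> : (j == m) = (j == 2%N :> nat) by rewrite -m2.
have [->|j1] := eqVneq j i1; first by rewrite /=; ring.
have [->|j2] := eqVneq j i2; first by rewrite /=; ring.
by case: (_ == _) => /=; ring.
Qed.

End NormalFormReflections.

(** * Classification of the pairs *)

Lemma prim_root_neq1 (K : nzRingType) (k : nat) (z : K) :
  (2 <= k)%N -> k.-primitive_root z -> z != 1.
Proof.
move=> k2 zk; apply/eqP => z1; have := prim_order_dvd zk 1.
by rewrite z1 expr1n eqxx dvdn1 => /eqP k1; rewrite k1 in k2.
Qed.

Theorem theorem4p11 (R : realType) (n : nat) (n_ge2 : (2 <= n)%N)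
    (k1 k2 : nat) (k1_ge2 : (2 <= k1)%N) (k2_ge2 : (2 <= k2)%N)
    (l1 l2 : Cplx R)
    (l1_prim : k1.-primitive_root l1) (l2_prim : k2.-primitive_root l2)
    (a1 a2 : 'rV[Cplx R]_n) :
  let b1 := beta1 n_ge2 l1 a1 in
  let b2 := beta2 n_ge2 l2 a2 in
  let a12 := a1 0 (ix2 n_ge2) in
  let a21 := a2 0 (ix1 n_ge2) in
  let Lambda := generated_group b1 b2 in
  let d := (l1 - 1) * (l2 - 1) in
  let proportional_tails :=
    forall j : 'I_n, (2 <= j)%N -> a2 0 j = a21 / (l1 - 1) * a1 0 j in
  (abelian_germs Lambda ->
     equivalent_pairs (b1, b2) (phi1 n_ge2 l1, phi2 n_ge2 l2)) /\
  (~ abelian_germs Lambda ->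
     (a12 * a21 <> d ->
        (a21 = 0 ->
           equivalent_pairs (b1, b2) (gamma1 n_ge2 l1 1, phi2 n_ge2 l2)) /\
        (a21 <> 0 ->
           equivalent_pairs (b1, b2)
             (gamma1 n_ge2 l1 (a12 * a21), gamma2 n_ge2 l2))) /\
     ((3 <= n)%N -> a12 * a21 = d ->
        (proportional_tails ->
           equivalent_pairs (b1, b2)
             (gamma1 n_ge2 l1 d, gamma2 n_ge2 l2)) /\
        (~ proportional_tails ->
           equivalent_pairs (b1, b2)
             (gamma1 n_ge2 l1 d, gamma2_third n_ge2 l2)))).
Proof.
move=> b1 b2 a12 a21 Lambda d proportional_tails.
have l10 : l1 - 1 != 0 by rewrite subr_eq0 (prim_root_neq1 k1_ge2 l1_prim).
have l20 : l2 - 1 != 0 by rewrite subr_eq0 (prim_root_neq1 k2_ge2 l2_prim).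
pose i1 := ix1 n_ge2; pose i2 := ix2 n_ge2.
have i12 : i1 != i2 by [].
pose u : 'rV[Cplx R]_n := \row_j if j == i1 then l1 - 1 else a1 0 j.
pose v : 'rV[Cplx R]_n := \row_j if j == i2 then l2 - 1 else a2 0 j.
have b1E : b1 = refl i1 u by exact: beta1E.
have b2E : b2 = refl i2 v by exact: beta2E.
have u1 : u 0 i1 = l1 - 1 by rewrite mxE eqxx.
have u2 : u 0 i2 = a12 by rewrite mxE.
have v1 : v 0 i1 = a21 by rewrite mxE.
have v2 : v 0 i2 = l2 - 1 by rewrite mxE eqxx.
have w1 a b : vec12 n_ge2 a b 0 i1 = a :> Cplx R by rewrite vec12E eqxx.
have w2 a b : vec12 n_ge2 a b 0 i2 = b :> Cplx R by rewrite vec12E eqxx.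
have uvE : u 0 i1 * v 0 i2 - u 0 i2 * v 0 i1 = d - a12 * a21.
  by rewrite u1 u2 v1 v2.
rewrite b1E b2E; split=> [ab|nab].
  have /(_ _ _ (gen_left _ _) (gen_right _ _)) comm := ab.
  rewrite b1E b2E in comm.
  have a12_0 : a12 = 0.
    by rewrite -u2; apply: germs_commute_refl_coord comm; rewrite ?v2.
  have a21_0 : a21 = 0.
    rewrite -v1; apply: germs_commute_refl_coord (germs_commute_sym comm).
      by rewrite eq_sym.
    by rewrite u1.
  rewrite phi1E phi2E.
  apply: (equivalent_refl_independent (oner_neq0 _)).
  - by rewrite uvE a12_0 mul0r subr0 mulf_neq0.
  - by rewrite w1.
  - by rewrite w2 u2 a12_0 mulr0.
  - by rewrite w1 v1 a21_0 mulr0.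
  - by rewrite w2.
(* If both cross entries vanished, the generators would commute and the group would be Abelian. *)
have a120 : a21 = 0 -> a12 != 0.
  move=> a21_0; apply/eqP => a12_0; apply: nab.
  rewrite /Lambda b1E b2E; apply: abelian_generated.
  - exact: refl_continuous_germ.
  - exact: refl_continuous_germ.
  - by apply: germs_commute_refl; rewrite ?u2 ?v1.
split=> [aad|n_ge3 aad].
  have D0 : u 0 i1 * v 0 i2 - u 0 i2 * v 0 i1 != 0.
    by rewrite uvE subr_eq0 eq_sym; apply/eqP.
  split=> [a21_0|/eqP a210].
    have {}a120 := a120 a21_0.
    (* Scaling x_2 by the inverse of [a12] turns the coefficient [a12] into 1. *)
    have q0 : a12^-1 != 0 by rewrite invr_eq0.
    rewrite gamma1E phi2E; apply: (equivalent_refl_independent q0) => //.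
    - by rewrite w1.
    - by rewrite w2 u2 mulVf.
    - by rewrite w1 v1 a21_0 mulr0.
    - by rewrite w2.
  (* Here the scaling [a21] turns the coefficient [a21] of the second map into 1, and [a12] into
     [a12 * a21]. *)
  rewrite gamma1E gamma2E; apply: (equivalent_refl_independent a210) => //.
  - by rewrite w1.
  - by rewrite w2 u2 mulrC.
  - by rewrite w1 v1 mulr1.
  - by rewrite w2.
have d0 : d != 0 by rewrite mulf_neq0.
have a210 : a21 != 0.
  by apply: contraNneq d0 => a21_0; rewrite -aad a21_0 mulr0.
(* Chosen so that [v - t *: u] vanishes at x_1; by [aad] it vanishes at x_2 as well. *)
pose t := a21 / (l1 - 1).
pose w : 'rV[Cplx R]_n := v - t *: u.
have vE : v = t *: u + w by rewrite addrC subrK.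
have wE j : w 0 j = v 0 j - t * u 0 j by rewrite !mxE.
have wi1 : w 0 i1 = 0 by rewrite wE u1 v1 divfK ?subrr.
have wi2 : w 0 i2 = 0.
  rewrite wE u2 v2 /t mulrAC [a21 * _]mulrC aad /d.
  by rewrite mulrAC divff // mul1r subrr.
(* With q = [a21], the part [(t / q) *: u'] of the target vector is exactly that of [gamma2]. *)
have tailE : t / a21 *: vec12 n_ge2 (l1 - 1) d = vec12 n_ge2 1 (l2 - 1).
  have -> : t / a21 = (l1 - 1)^-1 by rewrite /t mulrAC divff // mul1r.
  by rewrite /vec12 scalerDr !scalerA mulVf // /d mulKf.
have w_tail (j : 'I_n) : (2 <= j)%N -> w 0 j = a2 0 j - t * a1 0 j.
  move=> j2; rewrite wE !mxE.
  have [ji|_] := eqVneq j i2; first by rewrite ji in j2.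
  by have [ji|//] := eqVneq j i1; rewrite ji in j2.
clearbody w; rewrite gamma1E vE; split=> [prop|nprop].
  have w0 : w = 0.
    apply/rowP => j; rewrite mxE.
    case: (leqP 2 j) => [j2|]; first by rewrite w_tail // prop // subrr.
    case: j => -[|[|//]] jn _.
      by rewrite -[RHS]wi1; congr (w 0 _); exact: val_inj.
    by rewrite -[RHS]wi2; congr (w 0 _); exact: val_inj.
  (* No tail is left to move: take w' = 0 and F = 0. *)
  rewrite gamma2E -tailE -[t / a21 *: _]addr0.
  apply: (@equivalent_refl_dependent _ _ _ _ u w _ 0 0 a21 t);
    rewrite ?w0 ?scaler0 ?subrr ?mulmx0 ?scaler0 //.
  - by rewrite u1.
  - by rewrite mxE.
  - by rewrite mxE.
  - by rewrite mxE.
  - by rewrite mxE.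
  - by rewrite w1.
  - by rewrite w2 u2 mulrC aad.
  - by rewrite mxE addr0 oner_eq0.
pose m : 'I_n := Ordinal n_ge3.
have /(exists_form_neq0 m)[F wF Fm] : w != 0.
  apply/eqP => w0; apply: nprop => j j2.
  by apply/eqP; rewrite -subr_eq0 -w_tail // w0 mxE.
rewrite (gamma2_thirdE n_ge2 l2 (erefl : m = 2%N :> nat)) -tailE.
(* Here w' = e_3, so that [w] is sent to [a21] times e_3. *)
apply: (@equivalent_refl_dependent _ _ _ _ u w _ _ F a21 t) => //.
- by rewrite u1.
- by rewrite mxE.
- by rewrite mxE.
- by rewrite w1.
- by rewrite w2 u2 mulrC aad.
- by rewrite wF scale1r.
- rewrite mulmxBl -scalemxAl -rowE.
  have -> : (a21 *: row m F - w *m F) 0 0 = a21 * F m 0 - 1.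
    by rewrite [LHS]mxE [X in _ + X]mxE wF !mxE.
  by rewrite addrC subrK mulf_neq0.
Qed.
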